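(* Let $R$ be a ring (with identity, not necessarily commutative) and let $X$ be a locally finite partially ordered set such that $\mathrm{Min}(X)$ is a maximal antichain of $X$ and $\kappa(x)$ is finite for every $x\in \mathrm{Min}(X)$. Then $$\mathrm{Soc}_l(I(X,R)) = \bigoplus_{x\in \mathrm{Min}(X)} S(x,\mathrm{Soc}_l(R)).$$
   Context: A partially ordered set $X$ is locally finite if every interval $[x,y]=\{z\in X: x\le z\le y\}$ is finite. $\mathrm{Min}(X)$ is the set of minimal elements of $X$. For $x\in X$, $\kappa(x)=|\{y\in X: x\le y\}|$. An antichain is a set of pairwise incomparable elements; a maximal antichain is one that is maximal under inclusion among antichains of $X$. The incidence ring $I(X,R)$ is the set of functions $f:X\times X\to R$ with $f(x,y)=0$ unless $x\le y$, with pointwise addition and product $(fg)(x,y)=\sum_{x\le z\le y} f(x,z)g(z,y)$. For a left ideal $J$ of $R$, $I(X,J)$ denotes the set of $f\in I(X,R)$ all of whose values lie in $J$. For $x\in\mathrm{Min}(X)$ and a left ideal $J$ of $R$, $S(x,J)=\{f\in I(X,J): f(u,v)=0 \text{ if } u\ne x\}$; the direct sum is the internal direct sum inside $I(X,R)$. For a ring $A$, the left socle $\mathrm{Soc}_l(A)$ is the sum of all minimal left ideals of $A$. *)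

(* Defs.v *)
(* MathComp with the classical layer of MathComp-Analysis. *)
From HB Require Import structures.
From mathcomp Require Import all_boot all_order all_algebra.
From mathcomp Require Import finmap all_classical.

Set Implicit Arguments.
Unset Strict Implicit.
Unset Printing Implicit Defensive.

Import Order.TTheory GRing.Theory.
Local Open Scope classical_set_scope.
Local Open Scope ring_scope.

HB.mixin Record isLocallyFinite (d : Order.disp_t) X of Order.POrder d X := {
  finite_itv : forall x y : X, finite_set [set z : X | (x <= z <= y)%O]
}.

#[short(type="locFinPOrderType")]
HB.structure Definition LocFinPOrder (d : Order.disp_t) :=
  { X of isLocallyFinite d X & Order.POrder d X }.

Section Posets.
Context {d : Order.disp_t} {X : porderType d}.
Implicit Types (x y : X) (A B : set X).

Definition Min : set X := [set x | forall y, (y <= x)%O -> y = x].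

Definition up x : set X := [set y | (x <= y)%O].

Definition antichain A := forall x y, A x -> A y -> x <> y -> (x >< y)%O.

Definition maximal_antichain A :=
  antichain A /\ forall B, antichain B -> A `<=` B -> B = A.

End Posets.
Arguments Min {d} X.

Section IdealSums.
Context {V : nmodType} {I : choiceType}.
Implicit Types (D : set I) (L : I -> set V) (a : I -> V).

Definition fin_family D L : set (I -> V) :=
  [set a | (forall i, D i -> L i (a i)) /\
           finite_set [set i | D i /\ a i <> 0]].

(* The sum of the L i, i in D; it is the null set [set 0] when D is empty. *)
Definition sum_of D L : set V :=
  [set \sum_(i \in D) a i | a in fin_family D L].

Definition sum_is_direct D L :=
  forall a, fin_family D L a -> \sum_(i \in D) a i = 0 ->
  forall i, D i -> a i = 0.

End IdealSums.

Section Socle.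
Context {A : pzRingType}.
Implicit Types L K : set A.

(* On the regular module A^o, scaling is left multiplication, so that the *)
(* submodules of A^o are the left ideals of A.                            *)
Definition left_ideal L := GRing.submod_closed (mem L : {pred A^o}).

Definition minimal_left_ideal L :=
  [/\ left_ideal L, L <> [set 0] &
      forall K, left_ideal K -> K `<=` L -> K = [set 0] \/ K = L].

End Socle.

Definition left_socle (A : pzRingType) : set A :=
  sum_of [set L : set A | minimal_left_ideal L] id.
Arguments left_socle A : clear implicits.

Record incidence (d : Order.disp_t) (X : locFinPOrderType d)
    (R : pzRingType) := Incidence {
  incidence_fun :> X -> X -> R;
  incidence_supp : forall x y, ~ (x <= y)%O -> incidence_fun x y = 0
}.

Section IncidenceRing.
Context {d : Order.disp_t} {X : locFinPOrderType d} {R : pzRingType}.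
Implicit Types (f g h : incidence X R) (x y z : X).

Lemma incidence_ext f g : (forall x y, f x y = g x y) -> f = g.
Proof.
case: f g => [f Pf] [g Pg] /= fg.
have E : f = g by apply/funext => x; apply/funext => y.
by move: Pf Pg; rewrite E => Pf Pg; congr Incidence; exact: Prop_irrelevance.
Qed.

HB.instance Definition _ := gen_eqMixin (incidence X R).
HB.instance Definition _ := gen_choiceMixin (incidence X R).

Fact inc0_supp x y : ~ (x <= y)%O -> 0 = 0 :> R. Proof. by []. Qed.
Definition inc0 : incidence X R := Incidence inc0_supp.

Fact inc1_supp x y : ~ (x <= y)%O -> (x == y)%:R = 0 :> R.
Proof. by case: eqP => // ->; rewrite lexx. Qed.
Definition inc1 : incidence X R := Incidence inc1_supp.

Fact inc_opp_supp f x y : ~ (x <= y)%O -> - f x y = 0.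
Proof. by move=> /incidence_supp ->; rewrite oppr0. Qed.
Definition inc_opp f : incidence X R := Incidence (@inc_opp_supp f).

Fact inc_add_supp f g x y : ~ (x <= y)%O -> f x y + g x y = 0.
Proof. by move=> nxy; rewrite !incidence_supp// addr0. Qed.
Definition inc_add f g : incidence X R := Incidence (@inc_add_supp f g).

Fact inc_mul_supp f g x y : ~ (x <= y)%O ->
  \sum_(z \in [set z | (x <= z <= y)%O]) f x z * g z y = 0.
Proof.
by move=> nxy; apply: fsbig1 => z /= /andP[xz zy]; case: nxy; exact: le_trans zy.
Qed.
Definition inc_mul f g : incidence X R := Incidence (@inc_mul_supp f g).

Lemma inc_mulE f g x y x' y' : (x' <= x)%O -> (y <= y')%O ->
  inc_mul f g x y =
    \sum_(z <- fset_set [set z | (x' <= z <= y')%O]) f x z * g z y.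
Proof.
move=> x'x yy'; rewrite -fsbig_finite/=; last exact: finite_itv.
apply: fsbig_widen.
  by move=> z /= /andP[xz zy]; rewrite (le_trans x'x xz) (le_trans zy yy').
move=> z [/= _ nz] /=; have [xz|/negP xz] := boolP (x <= z)%O; last first.
  by rewrite (incidence_supp f xz) mul0r.
have [zy|/negP zy] := boolP (z <= y)%O; first by case: nz; rewrite xz.
by rewrite (incidence_supp g zy) mulr0.
Qed.

Fact inc_addA : associative inc_add.
Proof. by move=> f g h; apply: incidence_ext => x y /=; rewrite addrA. Qed.
Fact inc_addC : commutative inc_add.
Proof. by move=> f g; apply: incidence_ext => x y /=; rewrite addrC. Qed.
Fact inc_add0 : left_id inc0 inc_add.
Proof. by move=> f; apply: incidence_ext => x y /=; rewrite add0r. Qed.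
Fact inc_addN : left_inverse inc0 inc_opp inc_add.
Proof. by move=> f; apply: incidence_ext => x y /=; rewrite addNr. Qed.

HB.instance Definition _ :=
  GRing.isZmodule.Build (incidence X R) inc_addA inc_addC inc_add0 inc_addN.

Fact inc_mulA : associative inc_mul.
Proof.
move=> f g h; apply: incidence_ext => x y.
rewrite !(inc_mulE _ _ (lexx x) (lexx y)).
transitivity (\sum_(z <- fset_set [set z | (x <= z <= y)%O])
   \sum_(w <- fset_set [set z | (x <= z <= y)%O]) f x z * (g z w * h w y)).
  apply: eq_big_seq => z; rewrite in_fset_set; last exact: finite_itv.
  by move=> /set_mem/andP[xz zy]; rewrite (inc_mulE _ _ xz (lexx y)) mulr_sumr.
rewrite exchange_big; apply: eq_big_seq => w.
rewrite in_fset_set; last exact: finite_itv.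
move=> /set_mem/andP[xw wy]; rewrite (inc_mulE _ _ (lexx x) wy) mulr_suml.
by apply: eq_bigr => z _; rewrite mulrA.
Qed.

Fact inc_mul1l : left_id inc1 inc_mul.
Proof.
move=> f; apply: incidence_ext => x y; have [xy|/negP xy] := boolP (x <= y)%O.
  rewrite /= (fsbigD1 x)/=; [|exact: sub_finite_set (@finite_itv _ _ x y)|].
  - by rewrite eqxx mul1r fsbig1 ?addr0// => z [_ /eqP]; rewrite eq_sym => /negPf ->; rewrite mul0r.
  - by rewrite lexx.
by rewrite !incidence_supp.
Qed.

Fact inc_mul1r : right_id inc1 inc_mul.
Proof.
move=> f; apply: incidence_ext => x y; have [xy|/negP xy] := boolP (x <= y)%O.
  rewrite /= (fsbigD1 y)/=; [|exact: sub_finite_set (@finite_itv _ _ x y)|].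
  - by rewrite eqxx mulr1 fsbig1 ?addr0// => z [_ /eqP] /negPf ->; rewrite mulr0.
  - by rewrite lexx andbT.
by rewrite !incidence_supp.
Qed.

Fact inc_mulDl : left_distributive inc_mul +%R.
Proof.
move=> f g h; apply: incidence_ext => x y.
transitivity (inc_mul f h x y + inc_mul g h x y) => //.
rewrite !(inc_mulE _ _ (lexx x) (lexx y)) -big_split/=.
by apply: eq_bigr => z _; rewrite mulrDl.
Qed.

Fact inc_mulDr : right_distributive inc_mul +%R.
Proof.
move=> f g h; apply: incidence_ext => x y.
transitivity (inc_mul f g x y + inc_mul f h x y) => //.
rewrite !(inc_mulE _ _ (lexx x) (lexx y)) -big_split/=.
by apply: eq_bigr => z _; rewrite mulrDr.
Qed.

HB.instance Definition _ := GRing.Zmodule_isPzRing.Build (incidence X R)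
  inc_mulA inc_mul1l inc_mul1r inc_mulDl inc_mulDr.

Definition incidence_in (J : set R) : set (incidence X R) :=
  [set f | forall x y, J (f x y)].

(* S(x, J): the incidence functions with values in J, supported on row x. *)
Definition row_part (x : X) (J : set R) : set (incidence X R) :=
  incidence_in J `&` [set f | forall u v, u <> x -> f u v = 0].

End IncidenceRing.

(* Main.v *)
(** The support of a minimal left ideal [M] of I(X,R) is a single row, indexed
    by a minimal element: if [f] in [M] and [f u v <> 0], pick a minimal
    [x <= u]; then [M] is generated by [e_xu f], which is supported on row [x].
    As [x] is minimal, [(f g) x v = f x x * g x v], so the entries [g x v] of
    the [g] in [M] form a left ideal of [R] that is zero or minimal.
    Conversely [L e_xv] is a minimal left ideal whenever [L] is one, and a
    function supported on row [x] is a finite sum of its entries. *)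

Require Import Defs.
From mathcomp Require Import all_boot all_order all_algebra.
From mathcomp Require Import all_classical.

Set Implicit Arguments.
Unset Strict Implicit.
Unset Printing Implicit Defensive.

Import Order.TTheory GRing.Theory.
Local Open Scope classical_set_scope.
Local Open Scope ring_scope.

(** * Sums of families of additively closed sets *)

Section SumOf.
Context {V : nmodType} {I : choiceType}.
Implicit Types (D : set I) (L : I -> set V) (T : set V).

Definition add_closed T := T 0 /\ forall u v, T u -> T v -> T (u + v).

Lemma add_closed_fsbig T D (a : I -> V) :
  add_closed T -> (forall i, D i -> T (a i)) -> T (\sum_(i \in D) a i).
Proof.
move=> [T0 TD] Ta.
have [fin|inf] := pselect (finite_set (D `&` a @^-1` [set~ 0])); last first.
  (* With infinite support the sum is [0] by convention, and [0] lies in [T]. *)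
  by rewrite fsbig_dflt.
rewrite fsbig_supp fsbig_finite//= big_seq; apply: big_ind => // i.
by rewrite in_fset_set// => /set_mem [Di _]; exact: Ta.
Qed.

Lemma sum_of_sub D L T : add_closed T -> (forall i, D i -> L i `<=` T) ->
  sum_of D L `<=` T.
Proof.
move=> cT LT _ [a [La _] <-]; apply: add_closed_fsbig => // i Di.
exact: LT (La i Di).
Qed.

Lemma sub_sum_of D L i : (forall j, D j -> L j 0) -> D i -> L i `<=` sum_of D L.
Proof.
move=> L0 Di v Lv; exists (fun j => if j == i then v else 0).
  split=> [j Dj|]; first by case: eqP => [->|_] //; exact: L0.
  apply: (sub_finite_set (B := [set i])) => // j [_].
  by case: eqP.
rewrite -(fsbig_widen [set i])/=.
- by rewrite fsbig_set1 eqxx.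
- by move=> j ->.
- by move=> j [_ /=]; case: eqP.
Qed.

Lemma sum_of_closed D L : (forall i, D i -> add_closed (L i)) ->
  add_closed (sum_of D L).
Proof.
move=> cL; split.
  exists (fun=> 0); last by rewrite fsbig1.
  split=> [i /cL[]//|]; apply: (sub_finite_set (B := set0)) => // i [_].
  by case.
move=> _ _ [a [La fa] <-] [b [Lb fb] <-].
(* All three sums are restricted to the union of the two finite supports, where they can be split
   termwise. *)
set F := [set i | D i /\ a i <> 0] `|` [set i | D i /\ b i <> 0].
have finF : finite_set F by rewrite finite_setU.
have FD : F `<=` D by move=> i [[]|[]].
have Fa i : (D `\` F) i -> a i = 0.
  by move=> [Di nF]; apply: contrapT => ai; apply: nF; left.
have Fb i : (D `\` F) i -> b i = 0.
  by move=> [Di nF]; apply: contrapT => bi; apply: nF; right.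
exists (fun i => a i + b i).
  split=> [i Di|].
    by have [_ LD] := cL i Di; apply: LD; [exact: La|exact: Lb].
  apply: sub_finite_set finF => i [Di abi]; apply: contrapT => nF.
  by apply: abi; rewrite Fa// Fb// addr0.
rewrite -(fsbig_widen F D)//; last by move=> i Fi /=; rewrite Fa// Fb// addr0.
by rewrite -(fsbig_widen F D a)// -(fsbig_widen F D b)// fsbig_split.
Qed.

End SumOf.

(** * Left ideals and the left socle *)

Section LeftIdeals.
Context {A : pzRingType}.
Implicit Types L K : set A.

Lemma left_idealP L :
  left_ideal L <-> add_closed L /\ forall a u, L u -> L (a * u).
Proof.
split=> [[/set_mem L0 LD]|[[L0 LD] LM]].
  have LM a u : L u -> L (a * u).
    move=> Lu; rewrite -[_ * _]addr0; apply/set_mem.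
    by apply: (LD a u 0); exact: mem_set.
  split=> //; split=> // u v Lu Lv; rewrite -[u]mul1r; apply/set_mem.
  by apply: (LD 1 u v); exact: mem_set.
split; first exact: mem_set.
move=> a u v /set_mem Lu /set_mem Lv; apply/mem_set.
by apply: LD => //; exact: LM.
Qed.

Lemma ideal_neq0 L : left_ideal L -> L <> [set 0] -> exists2 u, L u & u <> 0.
Proof.
move=> /left_idealP[[L0 _] _] nL; apply: contrapT => h; apply: nL.
rewrite eqEsubset; split=> [u Lu|_ -> //].
by apply: contrapT => u0; apply: h; exists u.
Qed.

Lemma minimal_ideal_eq L K u : minimal_left_ideal L -> left_ideal K ->
  K `<=` L -> K u -> u <> 0 -> K = L.
Proof.
by move=> [_ _ minL] iK KL Ku u0; case: (minL K iK KL) => // K0; rewrite K0 in Ku.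
Qed.

Lemma left_socle_closed : add_closed (left_socle A).
Proof. by apply: sum_of_closed => L [/left_idealP[]]. Qed.

Lemma minimal_sub_socle L : minimal_left_ideal L -> L `<=` left_socle A.
Proof.
by move=> mL; apply: (sub_sum_of (L := id)) mL => K [/left_idealP[[]]].
Qed.

Lemma principal_left_ideal (u : A) : left_ideal [set a * u | a in setT].
Proof.
apply/left_idealP; split; first split.
- by exists 0; rewrite ?mul0r.
- by move=> _ _ [a _ <-] [b _ <-]; exists (a + b); rewrite ?mulrDl.
- by move=> a _ [b _ <-]; exists (a * b); rewrite ?mulrA.
Qed.

End LeftIdeals.

(** Otherwise [u] is incomparable with every minimal element, so adjoining it to [Min X] gives an
    antichain; by maximality [u] is then itself minimal, a contradiction. *)
Lemma Min_below (d : Order.disp_t) (X : porderType d) (u : X) :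
  maximal_antichain (Min X) -> exists2 x, Min X x & (x <= u)%O.
Proof.
move=> [aM maxM]; apply: contrapT => nx.
have cmp x : Min X x -> (x >< u)%O.
  move=> Mx; rewrite /Order.comparable negb_or; apply/andP; split; apply/negP.
    by move=> xu; apply: nx; exists x.
  by move=> /[dup] ux /Mx E; apply: nx; exists x => //; rewrite E.
suff E : Min X `|` [set u] = Min X by apply: nx; exists u => //; rewrite -E; right.
apply: maxM; last by move=> x; left.
move=> x y [Mx|->] [My|->] // xy.
- exact: aM.
- exact: cmp.
- by rewrite comparable_sym; exact: cmp.
Qed.

(** * Products with matrix units and with single-row functions *)

Section IncidenceSocle.
Context {d : Order.disp_t} {X : locFinPOrderType d} {R : pzRingType}.
Implicit Types (f g : incidence X R) (x y z u v : X) (J L : set R).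

(** The point [z] may lie outside the interval from [x] to [y]: both sides are then [0]. *)
Lemma inc_mul_single f g x y z :
  (forall w, w <> z -> f x w * g w y = 0) -> (f * g) x y = f x z * g z y.
Proof.
move=> h; change (inc_mul f g x y = f x z * g z y); rewrite /=.
have [xzy|xzy] := pselect (x <= z <= y)%O.
  rewrite -(fsbig_widen [set z])/=; first by rewrite fsbig_set1.
    by move=> w ->.
  by move=> w [_ /= wz]; exact: h.
have -> : f x z * g z y = 0.
  have [xz|/negP xz] := boolP (x <= z)%O; last by rewrite incidence_supp// mul0r.
  have [zy|/negP zy] := boolP (z <= y)%O; first by rewrite xz zy in xzy.
  by rewrite (incidence_supp g)// mulr0.
by apply: fsbig1 => w xwy; apply: h => wz; rewrite wz in xwy.
Qed.

Fact elem_supp x y (r : R) u v : ~ (u <= v)%O ->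
  (if [&& u == x, v == y & (x <= y)%O] then r else 0) = 0.
Proof. by case: and3P => // -[/eqP -> /eqP ->]. Qed.

(* [r e_xy], which is [0] unless [x <= y]. *)
Definition elem x y r : incidence X R := Incidence (@elem_supp x y r).

Lemma elem_mul x y r g u v : (x <= y)%O ->
  (elem x y r * g) u v = if u == x then r * g y v else 0.
Proof.
move=> xy; rewrite (inc_mul_single (z := y)) /=.
  by rewrite eqxx xy /= andbT; case: eqP => //; rewrite mul0r.
by move=> w /eqP/negPf ->; rewrite andbF mul0r.
Qed.

(** Only column [x] of [f] meets the single row of [g], and minimality of [x] leaves just the
    diagonal entry in that column. *)
Lemma row_mul x J f g u v : Min X x -> row_part x J g ->
  (f * g) u v = if u == x then f x x * g x v else 0.
Proof.
move=> Mx [_ gx]; rewrite (inc_mul_single (z := x)).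
  case: eqP => [-> //|ux]; rewrite incidence_supp ?mul0r// => ux'.
  by apply: ux; exact: Mx.
by move=> w wx; rewrite gx// mulr0.
Qed.

Lemma row_part_closed x J : add_closed J -> add_closed (row_part (X := X) x J).
Proof.
move=> [J0 JD]; split; first by split=> [u v|u v _].
move=> f g [fJ fx] [gJ gx]; split=> [u v|u v ux]; first exact: JD.
by change (f u v + g u v = 0); rewrite fx// gx// addr0.
Qed.

Lemma elemD x y r s : elem x y (r + s) = elem x y r + elem x y s.
Proof.
apply: incidence_ext => u v.
change (elem x y (r + s) u v = elem x y r u v + elem x y s u v) => /=.
by case: ifP; rewrite ?addr0.
Qed.

Lemma elem0 x y : elem x y 0 = 0.
Proof. by apply: incidence_ext => u v /=; case: ifP. Qed.

Lemma mul_elem x y r f : Min X x -> f * elem x y r = elem x y (f x x * r).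
Proof.
move=> Mx; apply: incidence_ext => u v; rewrite (row_mul (x := x) (J := setT))//=.
  by rewrite eqxx /=; case: eqP => //= _; case: ifP; rewrite ?mulr0.
by split=> // w z /eqP/negPf /= ->.
Qed.

Lemma elem_inj x y : (x <= y)%O -> injective (elem x y).
Proof.
by move=> xy r s /(congr1 (fun f : incidence X R => f x y)); rewrite /= !eqxx xy.
Qed.

(** * From the socle of [R] to the socle of the incidence ring *)

Lemma minimal_elem x y L : Min X x -> (x <= y)%O -> minimal_left_ideal L ->
  minimal_left_ideal [set elem x y r | r in L].
Proof.
move=> Mx xy mL; have [iL nL _] := mL.
have [[L0 LD] LM] := (left_idealP L).1 iL; split.
- apply/left_idealP; split; first split.
  + by exists 0; rewrite ?elem0.
  + by move=> _ _ [r Lr <-] [s Ls <-]; exists (r + s); rewrite ?elemD//; exact: LD.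
  + by move=> f _ [r Lr <-]; exists (f x x * r); rewrite ?mul_elem//; exact: LM.
- have [r Lr r0] := ideal_neq0 iL nL; move=> E; apply: r0.
  apply: (elem_inj xy); rewrite elem0.
  by rewrite -[_ = _]/([set 0] _) -E; exists r.
- move=> K iK KL; have [[K0 KD] KM] := (left_idealP K).1 iK.
  have [->|K_neq0] := pselect (K = [set 0]); [by left|right].
  have [_ /[dup] /KL[r Lr <-] Kr r0] := ideal_neq0 iK K_neq0.
  (* [K] is pulled back along the injection [elem x y] to a nonzero left ideal of [R] inside [L];
     minimality of [L] makes it all of [L]. *)
  have EL : [set r | K (elem x y r)] = L.
    apply: (minimal_ideal_eq (u := r)) => //=.
    + apply/left_idealP; split; first split.
      * by rewrite /= elem0.
      * by move=> s t /= Ks Kt; rewrite elemD; exact: KD.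
      (* By [mul_elem] the ring acts through diagonal entries at [x]; [elem x x a] realises the
         scalar [a]. *)
      * move=> a s /= Ks; have := KM (elem x x a) _ Ks.
        by rewrite mul_elem//= eqxx lexx.
    + by move=> s /= /KL[t Lt /(elem_inj xy) <-].
    + by move=> r00; apply: r0; rewrite r00 elem0.
  by rewrite eqEsubset; split=> // _ [s + <-]; rewrite -EL.
Qed.

Lemma elem_socle x y r : Min X x -> (x <= y)%O -> left_socle R r ->
  left_socle (incidence X R) (elem x y r).
Proof.
move=> Mx xy; have [S0 SD] := left_socle_closed (A := incidence X R).
(* The preimage of the socle under [elem x y] is additively closed, so it suffices that it contains
   each minimal left ideal. *)
apply: (sum_of_sub (T := [set r | left_socle _ (elem x y r)])).
  split=> [|s t /= Ss St]; first by rewrite /= elem0.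
  by rewrite elemD; exact: SD.
move=> L mL s Ls /=; apply: (minimal_sub_socle (minimal_elem Mx xy mL)).
by exists s.
Qed.

(** Finiteness of [D] matters: a family of infinite support sums to [0] by convention, even if its
    values at [(u, v)] have finite support. *)
Lemma inc_fsbigE (I : choiceType) (D : set I) (a : I -> incidence X R) u v :
  finite_set D -> (\sum_(i \in D) a i) u v = \sum_(i \in D) a i u v.
Proof.
move=> finD; rewrite !fsbig_finite//=.
by elim/big_rec2: _ => // i _ f _ <-.
Qed.

Lemma row_part_socle x : Min X x -> finite_set (up x) ->
  row_part x (left_socle R) `<=` left_socle (incidence X R).
Proof.
move=> Mx fin g [gS gx].
(* Finiteness of [up x] makes this expansion of row [x] into its entries a genuine finite sum. *)
have -> : g = \sum_(v \in up x) elem x v (g x v).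
  apply: incidence_ext => u w; rewrite inc_fsbigE//.
  have [->|ux] := pselect (u = x); last first.
    by rewrite gx// fsbig1// => v _ /=; case: eqP.
  have [xw|/negP xw] := boolP (x <= w)%O.
    rewrite -(fsbig_widen [set w])/=.
    - by rewrite fsbig_set1 !eqxx xw.
    - by move=> v ->.
    - by move=> v [_ /= vw]; rewrite eqxx /=; case: eqP => // wv; case: vw.
  rewrite incidence_supp// fsbig1// => v xv /=; rewrite eqxx /=.
  by case: eqP => // wv; case: xw; rewrite wv.
apply: add_closed_fsbig => [|v xv]; first exact: left_socle_closed.
exact: elem_socle.
Qed.

(** * Support and entries of a minimal left ideal *)

Lemma minimal_ideal_row M : maximal_antichain (Min X) ->
  minimal_left_ideal M ->
  exists2 x, Min X x & M `<=` row_part (R := R) x setT.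
Proof.
move=> max_Min mM; have [iM nM _] := mM.
have [f Mf f0] := ideal_neq0 iM nM.
have [u [v fuv]] : exists u v, f u v <> 0.
  apply: contrapT => h; apply: f0; apply: incidence_ext => u v /=.
  by apply: contrapT => fuv; apply: h; exists u, v.
have [x Mx xu] := Min_below u max_Min; exists x => //.
(* Row [u] of [f] is moved to row [x], so the entry at [(x, v)] is [f u v], which is nonzero. *)
have rowx : row_part x setT (elem x u 1 * f).
  by split=> // w z /eqP/negPf; rewrite elem_mul// => ->.
have [_ MM] := (left_idealP M).1 iM.
have <- : [set a * (elem x u 1 * f) | a in setT] = M.
  apply: (minimal_ideal_eq (u := elem x u 1 * f)) => //.
  - exact: principal_left_ideal.
  - by move=> _ [a _ <-]; exact: MM (MM _ _ Mf).
  - by exists 1; rewrite ?mul1r.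
  - move=> /(congr1 (fun f : incidence X R => f x v)).
    by rewrite elem_mul// eqxx mul1r.
move=> _ [a _ <-]; split=> // w z /eqP/negPf wx.
by rewrite (row_mul _ _ _ Mx rowx) wx.
Qed.

Lemma minimal_ideal_value M x v : Min X x -> minimal_left_ideal M ->
  M `<=` row_part (R := R) x setT ->
  forall g, M g -> left_socle R (g x v).
Proof.
move=> Mx mM Mrow g Mg; have [iM _ _] := mM.
have [[M0 MD] MM] := (left_idealP M).1 iM.
have MMv a h : M h -> (a * h) x v = a x x * h x v.
  by move=> /Mrow hrow; rewrite (row_mul _ _ _ Mx hrow) eqxx.
pose L := [set h x v | h in M].
have [gv0|gv0] := pselect (g x v = 0).
  by rewrite gv0; have [] := left_socle_closed (A := R).
apply: (minimal_sub_socle (L := L)); last by exists g.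
split.
- apply/left_idealP; split; first split.
  + by exists 0.
  + by move=> _ _ [h Mh <-] [k Mk <-]; exists (h + k) => //; exact: MD.
  + move=> a _ [h Mh <-]; exists (elem x x a * h); first exact: MM.
    by rewrite MMv//= eqxx lexx.
- by move=> L0; apply: gv0; rewrite -[_ = _]/([set 0] _) -L0; exists g.
- move=> K iK KL; have [[K0 KD] KM] := (left_idealP K).1 iK.
  have [->|nK] := pselect (K = [set 0]); [by left|right].
  have [_ /[dup] /KL[h Mh <-] Kh h0] := ideal_neq0 iK nK.
  (* Minimality is transferred from [M]: the elements of [M] whose entry at [(x, v)] lies in [K]
     form a left ideal, nonzero because it contains [h]. *)
  have EM : [set k | M k /\ K (k x v)] = M.
    apply: (minimal_ideal_eq (u := h)) => //.
    + apply/left_idealP; split; first by split=> // k l [Mk Kk] [Ml Kl]; split;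
        [exact: MD|exact: KD].
      by move=> a k [Mk Kk]; split; [exact: MM|rewrite MMv//; exact: KM].
    + by move=> k [].
    + by move=> hE; apply: h0; rewrite hE.
  rewrite eqEsubset; split=> // _ [k + <-].
  by rewrite -EM => -[].
Qed.

End IncidenceSocle.

(** * The socle as a direct sum of rows *)

Theorem theorem3p0p2 (d : Order.disp_t) (X : locFinPOrderType d)
    (R : pzRingType)
    (max_Min : maximal_antichain (Min X))
    (fin_kappa : forall x : X, Min X x -> finite_set (up x)) :
  left_socle (incidence X R) =
    sum_of (Min X) (fun x => row_part x (left_socle R)) /\
  sum_is_direct (V := incidence X R) (Min X)
    (fun x => row_part x (left_socle R)).
Proof.
have rowD x : add_closed (row_part (X := X) x (left_socle R)).
  exact/row_part_closed/left_socle_closed.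
split.
  rewrite eqEsubset; split; apply: sum_of_sub.
  - by apply: sum_of_closed => x _.
  - move=> M mM g Mg; have [x Mx Mrow] := minimal_ideal_row max_Min mM.
    apply: (sub_sum_of (i := x) (L := fun x => row_part x (left_socle R))) => //.
      by move=> y _; have [] := rowD y.
    have [_ gx] := Mrow g Mg; split=> // u v.
    have [->|ux] := pselect (u = x); first exact: minimal_ideal_value Mg.
    by rewrite gx//; have [] := left_socle_closed (A := R).
  - exact: left_socle_closed.
  - by move=> x Mx; apply: row_part_socle => //; exact: fin_kappa.
move=> a [aS fa] sum0 x Mx; apply: incidence_ext => u v.
have [->|ux] := pselect (u = x); last by have [_ ->] := aS x Mx.
have [ax0|ax0] := pselect (a x = 0); first by rewrite ax0.
have /(congr1 (fun f : incidence X R => f x v)) := sum0.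
(* After restriction to the finite support the sum can be evaluated at [(x, v)]; the other summands
   vanish on row [x], which leaves [a x x v]. *)
rewrite fsbig_supp inc_fsbigE// -(fsbig_widen [set x])/=.
- by rewrite fsbig_set1.
- by move=> y ->; split.
- move=> y [[My _] /= yx]; have [_ ->//] := aS y My.
  by move=> xy; apply: yx.
Qed.
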